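(* Let $\{a_n\}_{n\ge1}$ be a sequence of positive real numbers. Then $\sum a_n$ converges if and only if there exists a sequence $\{q_n\}_{n\ge1}$ of positive real numbers such that $$q_n\frac{n+1}{n}-q_{n+1}\geq (n+1)a_{n+1}$$ for all $n$ sufficiently large. Moreover, if a sequence $\{q_n\}_{n\ge1}$ of positive real numbers satisfying $$q_n\frac{n+1}{n}-q_{n+1}\geq (n+1)a_{n+1}$$ for all $n$ sufficiently large also satisfies $$\lim_{n\to\infty}\left(q_n\frac{n+1}{n}-q_{n+1}\right)=0,$$ then $\lim_{n\to\infty} n a_n=0$. *)

(* Defs.v *)
From Stdlib Require Export Reals.
From Coquelicot Require Export Coquelicot.

(* Sequences {u_n}_{n>=1} are functions nat -> R whose value at 0 is junk. *)
Definition positive_seq (u : nat -> R) : Prop :=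
  forall n : nat, (1 <= n)%nat -> (0 < u n)%R.

Definition weighted_diff (q : nat -> R) (n : nat) : R :=
  (q n * (INR (n + 1) / INR n) - q (n + 1)%nat)%R.

(* Main.v *)
Require Import Defs.
From Stdlib Require Import Reals Lra Lia.
From Coquelicot Require Import Coquelicot.
Open Scope R_scope.

(** Put [b n = q n / n].  Dividing the inequality by [n + 1] turns it into
    [b n - b (n + 1) >= a (n + 1)]: the sequence [b] is positive and each of its
    decrements dominates the next term of [a].

    If such a [q] exists, the inequalities telescope from some rank [N] on, so
    the partial sums of [a] beyond [N] are at most [b N]
    ([telescoping_partial_sums_le]); having positive terms, the series converges
    ([ex_series_of_bounded_partial_sums]).  Conversely, if the series converges,
    its tails [b n = a (n + 1) + a (n + 2) + ...] are positive and have
    decrements exactly [a (n + 1)], so [q n = n * b n] works, with equality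
    ([weighted_diff_mul_INR]).

    For the last claim, [(n + 1) * a (n + 1)] lies between [0] and
    [weighted_diff q n], and the squeeze theorem applies. *)

Lemma weighted_diff_decrement (q : nat -> R) (n : nat) :
  (1 <= n)%nat ->
  weighted_diff q n = INR (n + 1) * (q n / INR n - q (n + 1)%nat / INR (n + 1)).
Proof.
  intros hn. unfold weighted_diff. field.
  split; apply not_0_INR; lia.
Qed.

Lemma weighted_diff_mul_INR (b : nat -> R) (n : nat) :
  (1 <= n)%nat ->
  weighted_diff (fun k => INR k * b k) n = INR (n + 1) * (b n - b (n + 1)%nat).
Proof.
  intros hn. unfold weighted_diff. field. apply not_0_INR; lia.
Qed.

Lemma ex_series_of_bounded_partial_sums (u : nat -> R) (M : R) :
  (forall n, 0 <= u n) -> (forall n, sum_n u n <= M) -> ex_series u.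
Proof.
  intros hu hM.
  destruct (ex_finite_lim_seq_incr (sum_n u) M) as [l hl].
  - intros n. rewrite sum_Sn. unfold plus; simpl. specialize (hu (S n)). lra.
  - exact hM.
  - exists l. exact hl.
Qed.

Lemma telescoping_partial_sums_le (u b : nat -> R) :
  (forall n, u n <= b n - b (S n)) ->
  forall n, sum_n u n <= b 0%nat - b (S n).
Proof.
  intros h n. induction n as [|n IH].
  - rewrite sum_O. apply h.
  - rewrite sum_Sn. unfold plus; simpl. specialize (h (S n)). lra.
Qed.

Lemma Series_positive (u : nat -> R) :
  ex_series u -> (forall n, 0 < u n) -> 0 < Series u.
Proof.
  intros hex hu.
  rewrite (Series_incr_1 u hex).
  (* Comparison of series only gives a weak inequality; the first term, set
     apart, makes the sum strictly positive. *)
  assert (h : 0 <= Series (fun k => u (S k))).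
  { rewrite <- (Rmult_0_l (Series (fun k => u (S k)))), <- Series_scal_l.
    apply Series_le.
    - intros n. specialize (hu (S n)). lra.
    - apply (ex_series_incr_1 u). exact hex. }
  specialize (hu 0%nat). lra.
Qed.

Theorem theorem4p7 (a : nat -> R) (ha : positive_seq a) :
  (ex_series (fun k : nat => a (k + 1)%nat) <->
   exists q : nat -> R,
     positive_seq q /\
     eventually (fun n : nat =>
       weighted_diff q n >= INR (n + 1) * a (n + 1)%nat)) /\
  (forall q : nat -> R,
     positive_seq q ->
     eventually (fun n : nat =>
       weighted_diff q n >= INR (n + 1) * a (n + 1)%nat) ->
     is_lim_seq (weighted_diff q) 0 ->
     is_lim_seq (fun n : nat => INR n * a n) 0).
Proof.
  split; [split|].
  - intros hex.
    set (tail := fun n => Series (fun k => a (n + k + 1)%nat)).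
    assert (htail : forall n, ex_series (fun k => a (n + k + 1)%nat)).
    { intros n. apply (ex_series_incr_n (fun k => a (k + 1)%nat) n). exact hex. }
    exists (fun n => INR n * tail n). split.
    + intros n hn. apply Rmult_lt_0_compat.
      * apply lt_0_INR; lia.
      * apply Series_positive; [apply htail|]. intros k. apply ha; lia.
    + exists 1%nat. intros n hn.
      rewrite weighted_diff_mul_INR by exact hn.
      assert (hstep : tail n = a (n + 1)%nat + tail (n + 1)%nat).
      { unfold tail at 1. rewrite Series_incr_1 by apply htail.
        rewrite Nat.add_0_r. f_equal.
        apply Series_ext. intros k. f_equal. lia. }
      rewrite hstep. apply Req_ge. ring.
  - intros [q [hq [N hN]]].
    (* The ratio q n / n is meaningful only from n = 1 on. *)
    set (M := S N).
    set (b := fun k => q (M + k)%nat / INR (M + k)).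
    apply (ex_series_incr_n (fun k => a (k + 1)%nat) M).
    apply (ex_series_of_bounded_partial_sums _ (b 0%nat)).
    + intros n. apply Rlt_le, ha. lia.
    + intros n.
      assert (hb : 0 < b (S n)).
      { apply Rdiv_lt_0_compat; [apply hq; lia | apply lt_0_INR; lia]. }
      enough (h : sum_n (fun k => a (M + k + 1)%nat) n <= b 0%nat - b (S n)) by lra.
      apply telescoping_partial_sums_le. intros k.
      assert (hk := hN (M + k)%nat ltac:(lia)).
      rewrite weighted_diff_decrement in hk by lia.
      unfold b. replace (M + S k)%nat with (M + k + 1)%nat by lia.
      apply Rmult_le_reg_l with (INR (M + k + 1)); [apply lt_0_INR; lia|].
      apply Rge_le. exact hk.
  - intros q hq [N hN] hlim.
    apply is_lim_seq_incr_1.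
    apply is_lim_seq_le_le_loc with (u := fun _ => 0) (w := weighted_diff q).
    + exists N. intros n hn. specialize (hN n hn).
      rewrite Nat.add_1_r in hN. split.
      * apply Rmult_le_pos; [apply pos_INR | apply Rlt_le, ha; lia].
      * apply Rge_le. exact hN.
    + apply is_lim_seq_const.
    + exact hlim.
Qed.
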